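(* Let $A\subset\mathbb{R}$ be a finite set of Szemerédi–Trotter type with parameter $\alpha\ge 1$ and constant $c(A)$. Then $$|A+A| \gg c(A)^{\frac{1-11\alpha}{3\alpha^2+12\alpha+1}}\, |A|^{\frac{-8\alpha^2+57\alpha-3}{3\alpha^2+12\alpha+1}} \,(\log |A|)^{-\frac{4(3\alpha-1)}{3\alpha^2+12\alpha+1}} .$$ In particular, for $\alpha=2$, $$|A+A| \gg c(A)^{-\frac{21}{37}} |A|^{\frac{79}{37}} (\log |A|)^{-\frac{20}{37}} .$$
   Context: For functions $f,g:\mathbb{R}\to\mathbb{C}$ with finite support, $(f*g)(x)=\sum_y f(y)g(x-y)$; sets are identified with their indicator functions, so $(A*B)(x)$ is the number of representations $x=a+b$, $a\in A$, $b\in B$. A finite set $A\subset\mathbb{R}$ has Szemerédi–Trotter type (SzT-type) with parameter $\alpha\ge1$ if there is a constant $c(A)>0$ depending only on $A$ such that for every finite set $B\subset\mathbb{R}$ and every real $\tau\ge1$, $$|\{x\in A+B : (A*B)(x)\ge\tau\}| \ll c(A)\,|B|^{\alpha}\,\tau^{-3},$$ with an absolute implied constant. The symbols $\ll,\gg$ denote inequalities up to absolute positive constants. Logarithms are base 2. *)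

(* Defs.v *)
From HB Require Import structures.
From mathcomp Require Import all_boot all_order all_algebra finmap.
From mathcomp Require Import boolp classical_sets fsbigop reals.
From mathcomp Require Import numfun exp.

Set Implicit Arguments.
Unset Strict Implicit.
Unset Printing Implicit Defensive.

Import Order.TTheory GRing.Theory Num.Theory.
Local Open Scope ring_scope.

(* The sum is [fsbigop]'s sum over the support of the summand, hence the usual
   convolution when f or g has finite support. *)
Definition conv (G : zmodType) (K : pzRingType) (f g : G -> K) (x : G) : K :=
  \sum_(y \in [set: G]%classic) (f y * g (x - y)).

Definition sumset (G : zmodType) (A B : {fset G}) : {fset G} :=
  [fset (a + b)%R | a in A, b in B]%fset.

Definition conv_fset (R : realType) (A B : {fset R}) : R -> R :=
  conv (\1_[set` A]%classic : R -> R) (\1_[set` B]%classic : R -> R).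

Definition log2 (R : realType) (x : R) : R := ln x / ln 2.

(* c is the constant c(A). C0 is the absolute constant implied by << in the
   defining bound: it must be fixed before A, alpha and c. *)
Definition SzT_type (R : realType) (C0 : R) (A : {fset R}) (alpha c : R) :=
  [/\ 1 <= alpha, 0 < c &
      forall (B : {fset R}) (tau : R), 1 <= tau ->
        #|` [fset x in sumset A B | tau <= conv_fset A B x]%fset|%:R
          <= C0 * (c * #|` B|%:R `^ alpha * tau ^- 3)].

(* Main.v *)
(** Write [N = |A|], [S = A + A], [K = |S| / N], [d = N^(4 - alpha) / c] and
    [L = log N]; the claim is [K^q >> d^(11 alpha - 1) L^(- 4 (3 alpha - 1))] with
    [q = 3 alpha^2 + 12 alpha + 1], and it is trivial for [alpha > 3].  For
    [alpha <= 3] we follow Rudnev and Stevens.  Let [P] be the set of popular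
    sums, [A1] the set of [a] in [A] with [a + b] in [P] for half of the [b], and
    [D] the set of differences with at least [k] representations in [A1 - A1].
    By the tautology [a - c' = (a + b) - (c' + b)] and Cauchy-Schwarz,
    [(k |D| N)^2 << E_3(A) |M|] with [M] the set of pairs [(s, t)] in [P x S]
    such that [s - t] is in [D].  Popularity gives
    [|M| << (K / N) \sum_z (A - S)(z) (D - A)(z)], which Hölder's inequality with
    exponents 3, 3, 3 and the Szemerédi-Trotter hypothesis for [S] and [D]
    estimate.  This bounds [k^12 |D|^(9 - alpha)].  Finally
    [\sum_k k |D_k| >> N^3 / K], where only a range of [k] of multiplicative
    length [K^2 / d] matters: the loss [log (K^2 / d) << (K^2 / d)^(1/8)] in the
    summation costs no power of [L].  The outcome is a bound for [K] which
    is stronger than the claimed one for every [alpha] in [[1, 3]]. *)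

Require Import Defs.
From mathcomp Require Import all_boot all_order all_algebra finmap.
From mathcomp Require Import boolp classical_sets fsbigop reals.
From mathcomp Require Import numfun sequences exp ring lra zify.

Set Implicit Arguments.
Unset Strict Implicit.
Unset Printing Implicit Defensive.

Import Order.TTheory GRing.Theory Num.Theory.
Local Open Scope ring_scope.

(** * Representation functions of sums and differences *)

Section NatSums.
Local Open Scope nat_scope.

Lemma leq_sum_seq (I : eqType) (s : seq I) (F G : I -> nat) :
  {in s, forall i, F i <= G i} -> \sum_(i <- s) F i <= \sum_(i <- s) G i.
Proof.
by move=> FG; rewrite big_seq [leqRHS]big_seq; apply: leq_sum => i; apply: FG.
Qed.

Lemma leq_sum_sub (I : eqType) (s s' : seq I) (F : I -> nat) :
  uniq s -> uniq s' -> {subset s <= s'} ->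
  \sum_(i <- s) F i <= \sum_(i <- s') F i.
Proof. by move=> us us' ss'; apply: uniq_sub_le_big => // x y; exact: leq_addr. Qed.

Lemma sum_eq_mul (I : eqType) (s : seq I) (y : I) (h : I -> nat) : uniq s ->
  \sum_(x <- s) (x == y) * h x = (y \in s) * h y.
Proof.
elim: s => [|x s IH] /=; first by rewrite big_nil.
case/andP=> xs us; rewrite big_cons (IH us) in_cons eq_sym.
by case: eqVneq => [->|_] //=; rewrite (negbTE xs) addn0.
Qed.

Lemma sum_eq_mem (I : eqType) (s : seq I) (y : I) : uniq s ->
  \sum_(x <- s) (x == y) = (y \in s).
Proof.
move=> us; rewrite -[RHS]muln1 -(sum_eq_mul y (fun=> 1) us).
by under [RHS]eq_bigr do rewrite muln1.
Qed.

Lemma sum1_fset (T : choiceType) (A : {fset T}) : \sum_(x <- A) 1 = #|` A|.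
Proof. by rewrite sum1_size. Qed.

Lemma sum_mem_card (T : choiceType) (Z : {fset T}) (p : pred T) :
  \sum_(x <- Z) p x = #|` [fset x in Z | p x]%fset|.
Proof.
rewrite -sum1_size big_fset /= -big_mkcondr big_mkcond /=.
by apply: eq_bigr => x _; case: (p x).
Qed.

(** Cauchy-Schwarz for a 0-1 weight. After doubling, both sides are sums over pairs [(i, j)]; a pair
    of weight 1 reduces to [2 f_i f_j <= f_i^2 + f_j^2]. *)
Lemma sqr_sum_leq (I : Type) (s : seq I) (P f : I -> nat) :
  (forall i, P i <= 1) ->
  (\sum_(i <- s) P i * f i) ^ 2 <= (\sum_(i <- s) P i) * \sum_(i <- s) f i ^ 2.
Proof.
move=> P1; rewrite -(leq_pmul2l (isT : 0 < 2)) -mulnn big_distrlr /=.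
have -> : 2 * ((\sum_(i <- s) P i) * \sum_(i <- s) f i ^ 2) =
    \sum_(i <- s) \sum_(j <- s) (P i * f j ^ 2 + P j * f i ^ 2).
  rewrite mul2n -addnn; under [RHS]eq_bigr do rewrite big_split /=.
  rewrite big_split /= big_distrlr /=; congr (_ + _).
  by rewrite exchange_big.
rewrite big_distrr /=; apply: leq_sum => i _.
rewrite big_distrr /=; apply: leq_sum => j _.
have := P1 i; have := P1 j; case: (P i) (P j) => [|[|//]] [|[|//]] _ _.
all: rewrite ?mul0n ?muln0 ?mul1n //.
by rewrite addnC; case: (nat_Cauchy (f i) (f j)).
Qed.

End NatSums.

Section Representations.
Variable G : zmodType.
Implicit Types (A B D P S Z : {fset G}).

(** [rep] and [dif] are the convolutions of [A] with [B] and with [-B], kept in [nat] so that double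
    counting amounts to exchanging finite sums. *)
Definition rep A B (x : G) : nat := (\sum_(a <- A) ((x - a)%R \in B))%N.
Definition dif A B (x : G) : nat := (\sum_(b <- B) ((x + b)%R \in A))%N.
Definition oppset A : {fset G} := [fset - a | a in A]%fset.
Definition diffset A B : {fset G} := [fset (a - b)%R | a in A, b in B]%fset.

Local Open Scope nat_scope.

(** This is the change of variables [s = a + b] behind the double counts below. It comes from
    expanding membership in [A] as a sum of equalities over [A]. *)
Lemma sum_shift A P b (h : G -> nat) :
  \sum_(s <- P) ((s - b)%R \in A) * h s =
  \sum_(a <- A) ((a + b)%R \in P) * h (a + b)%R.
Proof.
under eq_bigr do rewrite -(sum_eq_mem _ (fset_uniq A)) big_distrl /=.
rewrite exchange_big /=; apply: eq_bigr => a _.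
rewrite -(sum_eq_mul _ h (fset_uniq P)); apply: eq_bigr => s _.
by rewrite eq_sym subr_eq.
Qed.

Lemma dif_sym A B x : dif A B x = \sum_(a <- A) ((a - x)%R \in B).
Proof.
have := sum_shift B A x (fun=> 1).
under eq_bigr do rewrite muln1.
under [RHS]eq_bigr do rewrite muln1.
by move=> ->; apply: eq_bigr => b _; rewrite addrC.
Qed.

Lemma dif_opp A D x : dif D A x = dif A D (- x)%R.
Proof.
by rewrite [RHS]dif_sym; apply: eq_bigr => a _; rewrite opprK addrC.
Qed.

Lemma rep_oppset A B x : rep A (oppset B) x = dif A B x.
Proof.
rewrite dif_sym; apply: eq_bigr => a _; congr nat_of_bool.
apply/imfsetP/idP => [[b bB /= E]|H].
  by rewrite -opprB E opprK.
by exists (a - x)%R => //; rewrite opprB.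
Qed.

Lemma card_oppset B : #|` oppset B| = #|` B|.
Proof. by rewrite card_imfset //; exact: oppr_inj. Qed.

Lemma rep_le A B x : rep A B x <= #|` A|.
Proof. by rewrite -sum1_fset; apply: leq_sum => a _; case: (_ \in _). Qed.

Lemma dif_le A B x : dif A B x <= #|` A|.
Proof. by rewrite -rep_oppset rep_le. Qed.

Lemma rep_sum A B Z (h : G -> nat) :
  \sum_(z <- Z) rep A B z * h z =
  \sum_(a <- A) \sum_(b <- B) ((a + b)%R \in Z) * h (a + b)%R.
Proof.
under eq_bigr do rewrite big_distrl /=.
rewrite exchange_big /=; apply: eq_bigr => a _.
by rewrite sum_shift; apply: eq_bigr => b _; rewrite addrC.
Qed.

Lemma dif_sum A B Z (h : G -> nat) :
  \sum_(z <- Z) dif A B z * h z =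
  \sum_(a <- A) \sum_(b <- B) ((a - b)%R \in Z) * h (a - b)%R.
Proof.
under eq_bigr do rewrite -rep_oppset.
rewrite rep_sum; apply: eq_bigr => a _.
by rewrite big_imfset //= => x y _ _; exact: oppr_inj.
Qed.

Lemma mem_sumset A B a b : a \in A -> b \in B -> (a + b)%R \in sumset A B.
Proof. by move=> aA bB; apply/imfset2P; exists a => //; exists b. Qed.

Lemma mem_diffset A B a b : a \in A -> b \in B -> (a - b)%R \in diffset A B.
Proof. by move=> aA bB; apply/imfset2P; exists a => //; exists b. Qed.

Lemma sum_rep_sumset A B (h : G -> nat) :
  \sum_(z <- sumset A B) rep A B z * h z =
  \sum_(a <- A) \sum_(b <- B) h (a + b)%R.
Proof.
rewrite rep_sum; apply: eq_big_seq => a aA; apply: eq_big_seq => b bB.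
by rewrite mem_sumset // mul1n.
Qed.

Lemma sum_dif_diffset A B (h : G -> nat) :
  \sum_(z <- diffset A B) dif A B z * h z =
  \sum_(a <- A) \sum_(b <- B) h (a - b)%R.
Proof.
rewrite dif_sum; apply: eq_big_seq => a aA; apply: eq_big_seq => b bB.
by rewrite mem_diffset // mul1n.
Qed.

Lemma sum_dif_le A B Z : \sum_(z <- Z) dif A B z <= #|` A| * #|` B|.
Proof.
under eq_bigr do rewrite -[dif _ _ _]muln1.
rewrite (dif_sum _ _ _ (fun=> 1)) -!sum1_fset big_distrlr /=.
by apply: leq_sum => a _; apply: leq_sum => b _; case: (_ \in _).
Qed.

Lemma card_sumset_ge A : #|` A| <= #|` sumset A A|.
Proof.
have [->|[a aA]] := fset_0Vmem A; first by rewrite cardfs0.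
have -> : #|` A| = #|` [fset (a + x)%R | x in A]%fset|.
  by rewrite card_imfset //; exact: addrI.
by apply: fsubset_leq_card; apply/fsubsetP => _ /imfsetP[x xA ->]; exact: mem_sumset.
Qed.

(** Both second moments count the quadruples of [A] with [a + b = c + d]; Cauchy-Schwarz for
    [rep A A] on [S] concludes. [S] is left free so that [rich A] can be combined with the sumset of
    all of [A]. *)
Lemma energy_ge A S : {in A &, forall a b, (a + b)%R \in S} ->
  #|` A| ^ 4 <= #|` S| * \sum_(x <- diffset A A) dif A A x ^ 2.
Proof.
move=> AS.
have -> : \sum_(x <- diffset A A) dif A A x ^ 2 = \sum_(s <- S) rep A A s ^ 2.
  transitivity (\sum_(a <- A) \sum_(b <- A) \sum_(c <- A) ((a + b - c)%R \in A)).
    transitivity (\sum_(x <- diffset A A) dif A A x * dif A A x); first by [].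
    rewrite sum_dif_diffset; apply: eq_bigr => a _.
    rewrite exchange_big /=; apply: eq_bigr => b _; apply: eq_bigr => c _.
    by rewrite addrAC.
  transitivity (\sum_(s <- S) rep A A s * rep A A s); last by [].
  rewrite rep_sum; apply: eq_big_seq => a aA; apply: eq_big_seq => b bA.
  by rewrite AS // mul1n.
have -> : #|` A| ^ 4 = (\sum_(s <- S) 1 * rep A A s) ^ 2.
  under eq_bigr do rewrite mul1n -[rep _ _ _]muln1.
  rewrite (rep_sum _ _ _ (fun=> 1)).
  rewrite -[4]/(2 * 2) expnM; congr (_ ^ 2).
  rewrite -mulnn -sum1_fset big_distrlr /=.
  by apply: eq_big_seq => a aA; apply: eq_big_seq => b bA; rewrite AS.
by rewrite -(sum1_fset S); apply: (@sqr_sum_leq _ _ (fun=> 1)).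
Qed.

End Representations.

(** * Popular sums and the triple count *)

Section Triples.
Variable G : zmodType.
Implicit Types (A D P S : {fset G}).
Local Open Scope nat_scope.

(** The threshold is a quarter of the mean [|A|^2 / |A + A|] of [rep A A] on the sumset, cleared of
    its denominator. *)
Definition popular A : {fset G} :=
  [fset s in sumset A A | #|` A| ^ 2 <= 4 * #|` sumset A A| * rep A A s]%fset.

Definition rich A : {fset G} :=
  [fset a in A | #|` A| <= 2 * \sum_(b <- A) ((a + b)%R \in popular A)]%fset.

Lemma in_popular A s : (s \in popular A) =
  (s \in sumset A A) && (#|` A| ^ 2 <= 4 * #|` sumset A A| * rep A A s).
Proof. by rewrite !inE /=. Qed.

Lemma in_rich A a : (a \in rich A) =
  (a \in A) && (#|` A| <= 2 * \sum_(b <- A) ((a + b)%R \in popular A)).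
Proof. by rewrite !inE /=. Qed.

Lemma rich_sub A : {subset rich A <= A}.
Proof. by move=> a; rewrite in_rich => /andP[]. Qed.

Lemma popular_sub A : {subset popular A <= sumset A A}.
Proof. by move=> a; rewrite in_popular => /andP[]. Qed.

(** Unpopular sums carry at most [|A|^2 / 4] pairs, while each element of [A] outside [rich A] takes
    part in at least [|A| / 2] of them. *)
Lemma card_rich A : #|` A| <= 2 * #|` rich A|.
Proof.
have [->|[a0 a0A]] := fset_0Vmem A; first by rewrite cardfs0.
set N := #|` A|; set S := sumset A A; set P := popular A.
have N0 : 0 < N by rewrite cardfs_gt0; apply/fset0Pn; exists a0.
have S0 : 0 < #|` S| by apply: leq_trans N0 (card_sumset_ge A).
pose bad := \sum_(a <- A) \sum_(b <- A) ((a + b)%R \notin P).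
have bad_le : 4 * bad <= N ^ 2.
  rewrite -(leq_pmul2l S0) mulnA [_ * 4]mulnC -/S.
  rewrite /bad -(sum_rep_sumset A A (fun s => s \notin P)) -/S.
  rewrite -sum1_fset big_distrr big_distrl /=; apply: leq_sum_seq => s sS.
  rewrite in_popular sS /= mul1n -ltnNge.
  rewrite sum1_fset; case: (ltnP _ (#|` A| ^ 2)) => [/ltnW|_]; last by rewrite !muln0.
  by rewrite muln1.
have h1 : \sum_(a <- A) (a \notin rich A) * N <= 2 * bad.
  rewrite /bad big_distrr /=; apply: leq_sum_seq => a aA.
  rewrite in_rich aA /= -/N -ltnNge.
  case: (ltnP _ N) => [h|_]; last by rewrite mul0n.
  rewrite mul1n.
  suff : N <= \sum_(b <- A) ((a + b)%R \notin P) + \sum_(b <- A) ((a + b)%R \in P).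
    move: h; rewrite -/P; move: (\sum_(b <- A) _) (\sum_(b <- A) _) => u v; lia.
  rewrite -big_split /= /N -sum1_fset; apply: leq_sum => b _.
  by case: (_ \in P).
have h2 : \sum_(a <- A) (a \notin rich A) + #|` rich A| = N.
  rewrite /N -[RHS]sum1_fset.
  have -> : #|` rich A| = \sum_(a <- A) (a \in rich A).
    rewrite sum_mem_card; suff -> : [fset x in A | x \in rich A]%fset = rich A by [].
    apply/fsetP => a; rewrite !inE /=.
    by rewrite andbA andbb.
  by rewrite -big_split /=; apply: eq_bigr => a _; case: (_ \in _).
move: h1; rewrite -big_distrl /= => h1.
have : (2 * \sum_(a <- A) (a \notin rich A)) * N <= N * N.
  by rewrite -mulnA mulnn; apply: leq_trans bad_le; rewrite -[4]/(2 * 2) -mulnA leq_mul2l.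
rewrite leq_pmul2r //; move: h2; move: (\sum_(a <- A) _) (#|` rich A|) (N) => u r n; clear; lia.
Qed.

Definition popular_pairs A D : nat :=
  \sum_(s <- popular A) \sum_(t <- sumset A A) ((s - t)%R \in D).

(* The sum of cubes bounds the number of pairs of triples (a, c, b), (a', c', b')
   with the same image under (a, c, b) |-> (a + b, c + b), since these satisfy
   a - a' = c - c' = b' - b. *)
Lemma rich_triples A D :
  (#|` A| * \sum_(x <- D) dif (rich A) (rich A) x) ^ 2 <=
  4 * (popular_pairs A D * \sum_(z <- diffset A A) dif A A z ^ 3).
Proof.
set N := #|` A|; set S := sumset A A; set P := popular A; set A1 := rich A.
(* [m s t] is the size of the fibre over [(s, t)] of the map [(a, c, b) |-> (a + b, c + b)]. *)
pose m s t := \sum_(b <- A) ((s - b)%R \in A) * ((t - b)%R \in A).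
have T_le : N * \sum_(x <- D) dif A1 A1 x <=
    2 * \sum_(s <- P) \sum_(t <- S) ((s - t)%R \in D) * m s t.
  have -> : \sum_(s <- P) \sum_(t <- S) ((s - t)%R \in D) * m s t =
     \sum_(b <- A) \sum_(a <- A) \sum_(c <- A)
        ((a + b)%R \in P) * (((a - c)%R \in D) * ((c + b)%R \in S)).
    under eq_bigr do (under eq_bigr do rewrite big_distrr /=; rewrite exchange_big /=).
    rewrite exchange_big /=; apply: eq_bigr => b _.
    transitivity (\sum_(s <- P) ((s - b)%R \in A) *
        \sum_(t <- S) ((t - b)%R \in A) * ((s - t)%R \in D)).
      apply: eq_bigr => s _; rewrite big_distrr /=; apply: eq_bigr => t _.
      by rewrite mulnC -mulnA.
    rewrite (sum_shift A P b (fun s => \sum_(t <- S) ((t - b)%R \in A) * ((s - t)%R \in D))).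
    apply: eq_bigr => a _.
    rewrite (sum_shift A S b (fun t => ((a + b - t)%R \in D) : nat)).
    rewrite big_distrr /=; apply: eq_bigr => c _.
    by rewrite [X in _ * X]mulnC opprD addrACA subrr addr0.
  have -> : \sum_(x <- D) dif A1 A1 x = \sum_(a <- A1) \sum_(c <- A1) ((a - c)%R \in D).
    under eq_bigr do rewrite -[dif _ _ _]muln1.
    rewrite (dif_sum _ _ _ (fun=> 1)).
    by apply: eq_bigr => a _; apply: eq_bigr => c _; rewrite muln1.
  (* Richness of [a] supplies at least [|A| / 2] elements [b] with [a + b] popular, hence the factor
     2. *)
  apply: (@leq_trans (2 * \sum_(a <- A1) \sum_(c <- A1) \sum_(b <- A)
        ((a + b)%R \in P) * ((a - c)%R \in D))).
    rewrite !big_distrr /=; apply: leq_sum_seq => a aA1.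
    rewrite !big_distrr /=; apply: leq_sum_seq => c _.
    rewrite -big_distrl /= mulnA leq_mul2r; apply/orP; right.
    by move: aA1; rewrite in_rich => /andP[].
  rewrite leq_mul2l /=.
  rewrite [leqRHS]exchange_big /=.
  apply: leq_trans (leq_sum_sub _ (fset_uniq _) (fset_uniq _) (@rich_sub A)).
  apply: leq_sum => a _.
  rewrite [leqRHS]exchange_big /=.
  apply: leq_trans (leq_sum_sub _ (fset_uniq _) (fset_uniq _) (@rich_sub A)).
  apply: leq_sum_seq => c /rich_sub cA; apply: leq_sum_seq => b bA.
  by rewrite (mem_sumset cA bA) muln1.
have m2 : \sum_(s <- P) \sum_(t <- S) m s t ^ 2 <=
    \sum_(z <- diffset A A) dif A A z ^ 3.
  apply: (@leq_trans (\sum_(s <- S) \sum_(t <- S) m s t ^ 2)).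
    apply: leq_sum_sub; rewrite ?fset_uniq //; exact: popular_sub.
  have -> : \sum_(z <- diffset A A) dif A A z ^ 3 =
      \sum_(b <- A) \sum_(b' <- A) dif A A (b - b')%R ^ 2.
    rewrite -(sum_dif_diffset A A (fun z => dif A A z ^ 2)).
    by apply: eq_bigr => z _; rewrite -expnS.
  (* Summing over [(s, t)] first turns the count of fibre pairs into [w b b' ^ 2]. With [a = s - b]
     the second condition reads [a + b - b'] in [A], so [w b b'] is at most [dif A A (b - b')]. *)
  pose w b b' := \sum_(s <- S) ((s - b)%R \in A) * ((s - b')%R \in A).
  have -> : \sum_(s <- S) \sum_(t <- S) m s t ^ 2 =
      \sum_(b <- A) \sum_(b' <- A) w b b' ^ 2.
    transitivity (\sum_(s <- S) \sum_(t <- S) \sum_(b <- A) \sum_(b' <- A)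
        (((s - b)%R \in A) * ((s - b')%R \in A)) *
        (((t - b)%R \in A) * ((t - b')%R \in A))).
      apply: eq_bigr => s _; apply: eq_bigr => t _.
      rewrite -mulnn big_distrlr /=; apply: eq_bigr => b _; apply: eq_bigr => b' _.
      by rewrite mulnACA.
    transitivity (\sum_(s <- S) \sum_(b <- A) \sum_(b' <- A) \sum_(t <- S)
        (((s - b)%R \in A) * ((s - b')%R \in A)) *
        (((t - b)%R \in A) * ((t - b')%R \in A))).
      apply: eq_bigr => s _; rewrite exchange_big /=; apply: eq_bigr => b _.
      by rewrite exchange_big.
    rewrite exchange_big /=; apply: eq_bigr => b _.
    rewrite exchange_big /=; apply: eq_bigr => b' _.
    by rewrite -mulnn big_distrlr.
  apply: leq_sum => b _; apply: leq_sum => b' _; rewrite leq_exp2r //.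
  rewrite /w (sum_shift A S b (fun s => ((s - b')%R \in A) : nat)).
  apply: leq_sum => a _; rewrite -addrA [(b - b' + a)%R]addrC.
  by case: (_ \in S); rewrite ?mul1n.
apply: (@leq_trans ((2 * \sum_(s <- P) \sum_(t <- S) ((s - t)%R \in D) * m s t) ^ 2)).
  by rewrite leq_exp2r.
rewrite expnMn leq_mul2l /=.
apply: leq_trans (leq_mul (leqnn _) m2).
pose s := [seq (x, y) | x <- P, y <- S].
have E (F : G -> G -> nat) :
    \sum_(x <- P) \sum_(y <- S) F x y = \sum_(p <- s) F p.1 p.2.
  by rewrite big_allpairs.
rewrite /popular_pairs !E.
by apply: sqr_sum_leq => p; case: (_ \in D).
Qed.

(** For popular [s] the factor [4 |S| rep A A s / |A|^2] is at least 1 and may be inserted. Then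
    [s = a + b] and [s - t = (a - t) + b], where [z = a - t] is counted by [dif A S] and [b] by
    [dif D A]. *)
Lemma popular_pairs_le A D :
  #|` A| ^ 2 * popular_pairs A D <= 4 * #|` sumset A A| *
    \sum_(z <- diffset A (sumset A A)) dif A (sumset A A) z * dif D A z.
Proof.
set S := sumset A A.
have -> : \sum_(z <- diffset A S) dif A S z * dif D A z =
    \sum_(s <- S) rep A A s * \sum_(t <- S) ((s - t)%R \in D).
  rewrite sum_rep_sumset sum_dif_diffset; apply: eq_bigr => a _.
  rewrite exchange_big /=; apply: eq_bigr => b _; apply: eq_bigr => t _.
  by rewrite addrAC.
rewrite /popular_pairs !big_distrr /=.
apply: (@leq_trans (\sum_(s <- popular A)
    4 * #|` S| * (rep A A s * \sum_(t <- S) ((s - t)%R \in D)))).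
  apply: leq_sum_seq => s sP; rewrite mulnA leq_mul2r; apply/orP; right.
  by move: sP; rewrite in_popular => /andP[].
apply: leq_sum_sub; rewrite ?fset_uniq //; exact: popular_sub.
Qed.

End Triples.

(** * Real inequalities *)

Section RealSums.
Variable R : realType.
Implicit Types (a b x : R).

Lemma AMGM3 a b x : 0 <= a -> 0 <= b -> 0 <= x ->
  27 * (a * b * x) <= (a + b + x) ^+ 3.
Proof.
move=> a0 b0 x0; rewrite -subr_ge0.
have -> : (a + b + x) ^+ 3 - 27 * (a * b * x) =
  (a + b + x) * ((a - b) ^+ 2 + (b - x) ^+ 2 + (x - a) ^+ 2) / 2 +
  3 * (a * (b - x) ^+ 2 + b * (x - a) ^+ 2 + x * (a - b) ^+ 2) by field.
move: (sqr_ge0 (a - b)) (sqr_ge0 (b - x)) (sqr_ge0 (x - a)).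
move: (_ ^+ 2) (_ ^+ 2) (_ ^+ 2) => u v w u0 v0 w0.
by rewrite addr_ge0 // ?divr_ge0 // ?mulr_ge0 // ?addr_ge0 // ?addr_ge0 // mulr_ge0.
Qed.

(** Hölder with exponents 3, 3, 3 for the factors [f], [g^(1/3)] and [g^(2/3)]. *)
Lemma hoelder3 (I : eqType) (s : seq I) (f g : I -> R) :
  (forall i, 0 <= f i) -> (forall i, 0 <= g i) ->
  (\sum_(i <- s) f i * g i) ^+ 3 <=
  (\sum_(i <- s) f i ^+ 3) * (\sum_(i <- s) g i) * (\sum_(i <- s) g i ^+ 2).
Proof.
move=> f0 g0.
set F := \sum_(i <- s) f i ^+ 3; set G1 := \sum_(i <- s) g i.
set G2 := \sum_(i <- s) g i ^+ 2.
(* If one of the three sums on the right vanishes, so does the sum on the left; from then on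
   division by them is allowed. *)
have sum_gt0 (h : I -> R) : (forall i, 0 <= h i) ->
    (forall i, h i = 0 -> f i * g i = 0) ->
    0 < \sum_(i <- s) h i \/ \sum_(i <- s) f i * g i = 0.
  move=> h0 hfg; have : 0 <= \sum_(i <- s) h i by exact: sumr_ge0.
  rewrite le_eqVlt => /orP[|]; last by left.
  rewrite eq_sym psumr_eq0 // => /allP hs; right.
  by rewrite big1_seq // => i /andP[_ /hs /eqP]; exact: hfg.
have RHS_ge0 : 0 <= F * G1 * G2.
  by rewrite !mulr_ge0 // sumr_ge0 // => i _; rewrite exprn_ge0.
have f3 i : 0 <= f i ^+ 3 by rewrite exprn_ge0.
have g2 i : 0 <= g i ^+ 2 by rewrite exprn_ge0.
have f3z i : f i ^+ 3 = 0 -> f i * g i = 0.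
  by move/eqP; rewrite expf_eq0 => /eqP ->; rewrite mul0r.
have g1z i : g i = 0 -> f i * g i = 0 by move=> ->; rewrite mulr0.
have g2z i : g i ^+ 2 = 0 -> f i * g i = 0.
  by move/eqP; rewrite expf_eq0 => /eqP ->; rewrite mulr0.
have [F0|E] := sum_gt0 _ f3 f3z; last by rewrite E expr0n.
have [G10|E] := sum_gt0 _ g0 g1z; last by rewrite E expr0n.
have [G20|E] := sum_gt0 _ g2 g2z; last by rewrite E expr0n.
pose q := (F * G1 * G2) `^ 3^-1.
have q3 : q ^+ 3 = F * G1 * G2.
  rewrite -powR_mulrn ?powR_ge0 // -powRrM.
  by rewrite (_ : 3^-1 * 3%:R = 1) ?powRr1 // mulVf // pnatr_eq0.
have q0 : 0 <= q by exact: powR_ge0.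
(* AM-GM for three terms, each normalised by its total: summed over [i] the bracket equals 3, which
   leaves [q]. *)
have pointwise i : f i * g i <= q / 3 * (f i ^+ 3 / F + g i / G1 + g i ^+ 2 / G2).
  have t0 : 0 <= f i ^+ 3 / F by rewrite divr_ge0 // ?exprn_ge0 // ltW.
  have u0 : 0 <= g i / G1 by rewrite divr_ge0 // ltW.
  have v0 : 0 <= g i ^+ 2 / G2 by rewrite divr_ge0 // ?exprn_ge0 // ltW.
  have w0 : 0 <= q / 3 * (f i ^+ 3 / F + g i / G1 + g i ^+ 2 / G2).
    by rewrite mulr_ge0 ?divr_ge0 // !addr_ge0.
  rewrite -(@ler_pXn2r _ 3) // ?nnegrE ?mulr_ge0 //.
  rewrite [leRHS]exprMn expr_div_n q3.
  apply: le_trans (ler_wpM2l _ (AMGM3 t0 u0 v0)).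
    rewrite le_eqVlt; apply/orP; left; apply/eqP; field.
    by rewrite !gt_eqF.
  by rewrite divr_ge0 // exprn_ge0.
rewrite -q3; apply: lerXn2r; rewrite ?nnegrE //.
  by apply: sumr_ge0 => i _; rewrite mulr_ge0.
apply: le_trans (ler_sum _ (fun i _ => pointwise i)) _.
rewrite -mulr_sumr !big_split /= -!mulr_suml -/F -/G1 -/G2 !divff ?gt_eqF //.
by rewrite le_eqVlt; apply/orP; left; apply/eqP; field.
Qed.

(** From [ln (k / (k + 1)) <= - 1 / (k + 1)]; the factor 2 covers [1 / k <= 2 / (k + 1)]. *)
Lemma inv_le_ln (k : nat) : (0 < k)%N ->
  k%:R^-1 <= 2 * (ln k.+1%:R - ln k%:R) :> R.
Proof.
move=> k0; have k0' : 0 < k%:R :> R by rewrite ltr0n.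
have k1' : 0 < k.+1%:R :> R by rewrite ltr0n.
rewrite -ln_div ?posrE // -[ln _]opprK -lnV ?posrE ?divr_gt0 // invf_div.
have -> : k%:R / k.+1%:R = 1 + (- k.+1%:R^-1) :> R.
  by rewrite -[k.+1%:R]natr1; field; rewrite natr1 gt_eqF.
have h : ln (1 + - k.+1%:R^-1 : R) <= - k.+1%:R^-1.
  by apply: le_ln1Dx; rewrite ltrN2 invf_lt1 ?ltr1n.
have h2 : k%:R^-1 <= 2 * k.+1%:R^-1 :> R.
  rewrite -[leLHS]mul1r ler_pdivrMr // mulrAC ler_pdivlMr // mul1r -natrM ler_nat.
  by lia.
by apply: le_trans h2 _; rewrite ler_pM2l // lerNr.
Qed.

Lemma sum_inv_le (M : nat) : \sum_(1 <= k < M.+1) k%:R^-1 <= 2 * ln M.+1%:R :> R.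
Proof.
apply: (@le_trans _ _ (\sum_(1 <= k < M.+1) 2 * (ln k.+1%:R - ln k%:R))).
  by apply: ler_sum_nat => k /andP[k0 _]; exact: inv_le_ln.
by rewrite -mulr_sumr telescope_sumr // ln1 subr0.
Qed.

Lemma sum_inv_range a b (M : nat) : 0 < a -> a <= b ->
  \sum_(1 <= k < M.+1 | a < k%:R <= b) k%:R^-1 <= 2 * (ln (b + 1) - ln a).
Proof.
(* The logarithm clamped to [[a, b + 1]] telescopes with nonnegative increments. It is the true
   logarithm at both [k] and [k + 1] when [a < k <= b], hence the [b + 1]. *)
move=> a0 ab; pose h (k : nat) : R := ln (Num.max a (Num.min k%:R (b + 1))).
have pos (k : nat) : 0 < Num.max a (Num.min k%:R (b + 1)).
  by rewrite lt_max a0.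
have h_mono k : h k <= h k.+1.
  by rewrite ler_ln ?posrE // le_max2 // le_min2 // ler_nat.
apply: (@le_trans _ _ (\sum_(1 <= k < M.+1) 2 * (h k.+1 - h k))).
  rewrite big_mkcond /=; apply: ler_sum_nat => k /andP[k0 _].
  case: ifP => [/andP[ak kb]|_]; last by rewrite mulr_ge0 // subr_ge0.
  have -> : h k = ln k%:R.
    by rewrite /h min_l ?max_r ?(ltW ak) // (le_trans kb) // lerDl.
  have -> : h k.+1 = ln k.+1%:R.
    rewrite /h min_l; last by rewrite -natr1 lerD2r.
    by rewrite max_r // (le_trans (ltW ak)) // ler_nat.
  exact: inv_le_ln.
rewrite -mulr_sumr telescope_sumr // ler_pM2l // lerB //.
  have b0 : 0 < b + 1 by rewrite ltr_wpDr // (lt_le_trans a0).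
  by rewrite ler_ln ?posrE // ge_max ge_min lexx orbT andbT ler_wpDr.
by rewrite ler_ln ?posrE // le_max lexx.
Qed.

Lemma sum_invsq_tail x (M : nat) : 0 < x ->
  \sum_(1 <= k < M.+1 | x < k%:R) k%:R ^- 2 <= 2 / x.
Proof.
(* Telescoping of [1 / max(x, k)], based on [1 / k^2 <= 2 (1 / k - 1 / (k + 1))]. *)
move=> x0; pose h (k : nat) : R := (Num.max x k%:R)^-1.
have pos (k : nat) : 0 < Num.max x k%:R by rewrite lt_max x0.
have h_anti k : h k.+1 <= h k.
  by rewrite lef_pV2 ?posrE // le_max2 // ler_nat.
apply: (@le_trans _ _ (\sum_(1 <= k < M.+1) 2 * (- h k.+1 - - h k))).
  rewrite big_mkcond /=; apply: ler_sum_nat => k /andP[k0 _].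
  have k0' : 0 < k%:R :> R by rewrite ltr0n.
  case: ifP => [xk|_]; last by rewrite mulr_ge0 // opprK addrC subr_ge0.
  have -> : h k = k%:R^-1 by rewrite /h max_r // ltW.
  have -> : h k.+1 = k.+1%:R^-1.
    by rewrite /h max_r // (le_trans (ltW xk)) // ler_nat.
  have -> : 2 * (- k.+1%:R^-1 - - k%:R^-1) = 2 / (k%:R * k.+1%:R) :> R.
    by rewrite -natr1; field; rewrite addrC natr1 !gt_eqF ?ltr0n.
  rewrite -[leLHS]mul1r ler_pdivrMr ?exprn_gt0 // mulrAC ler_pdivlMr ?mulr_gt0 ?ltr0n //.
  by rewrite mul1r -natrX -!natrM ler_nat; nia.
rewrite -mulr_sumr telescope_sumr // ler_pM2l // opprK.
have : 0 <= h M.+1 by rewrite invr_ge0 ltW.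
have : h 1%N <= x^-1 by rewrite lef_pV2 ?posrE // le_max lexx.
by lra.
Qed.

End RealSums.

(** * Moments from level set bounds *)

Section LayerCake.
Variables (R : realType) (T : choiceType) (Z : {fset T}) (r : T -> nat) (M : nat).
Hypothesis r_le : forall z, (r z <= M)%N.

Definition level (k : nat) : {fset T} := [fset z in Z | (k <= r z)%N]%fset.

Lemma layer_cake (phi : nat -> R) :
  \sum_(z <- Z) \sum_(1 <= k < (r z).+1) phi k =
  \sum_(1 <= k < M.+1) phi k * #|` level k|%:R.
Proof.
have E z : \sum_(1 <= k < (r z).+1) phi k =
    \sum_(1 <= k < M.+1) phi k * (k <= r z)%N%:R.
  rewrite (big_nat_widen 1 (r z).+1 M.+1) ?ltnS // big_mkcond /=.
  by apply: eq_bigr => k _; rewrite ltnS; case: leqP; rewrite ?mulr1 ?mulr0.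
under eq_bigr do rewrite E.
rewrite exchange_big /=; apply: eq_bigr => k _.
by rewrite -mulr_sumr -sum_mem_card natr_sum.
Qed.

Lemma sum_level : \sum_(1 <= k < M.+1) #|` level k|%:R = \sum_(z <- Z) (r z)%:R :> R.
Proof.
under eq_bigr do rewrite -[_%:R]mul1r.
rewrite -(layer_cake (fun=> 1)); apply: eq_bigr => z _.
by rewrite sumr_const_nat subn1.
Qed.

(** Layer cake with weight [2 k], since [(n + 1)^2 - n^2 <= 2 (n + 1)]; the cubes below use [3 k^2]
    in the same way. *)
Lemma sum_sqr_le : \sum_(z <- Z) (r z)%:R ^+ 2 <=
  \sum_(1 <= k < M.+1) 2 * k%:R * #|` level k|%:R :> R.
Proof.
rewrite -(layer_cake (fun k => 2 * k%:R)); apply: ler_sum => z _.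
elim: (r z) => [|n IH]; first by rewrite expr0n big_geq.
rewrite big_nat_recr //= -natr1.
have : 0 <= n%:R :> R by [].
by move: IH; nra.
Qed.

Lemma sum_cube_le : \sum_(z <- Z) (r z)%:R ^+ 3 <=
  \sum_(1 <= k < M.+1) 3 * k%:R ^+ 2 * #|` level k|%:R :> R.
Proof.
rewrite -(layer_cake (fun k => 3 * k%:R ^+ 2)); apply: ler_sum => z _.
elim: (r z) => [|n IH]; first by rewrite expr0n big_geq.
rewrite big_nat_recr //= -natr1.
have : 0 <= n%:R :> R by [].
by move: IH; nra.
Qed.

Variables (U V : R).
Hypothesis sum_r_le : \sum_(z <- Z) (r z)%:R <= U.
Hypothesis level_le : forall k : nat, (0 < k)%N -> #|` level k|%:R * k%:R ^+ 3 <= V.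

Lemma weak_ge0 : 0 <= V.
Proof. by apply: le_trans (level_le (ltn0Sn 0)); rewrite mulr_ge0 ?exprn_ge0. Qed.

(** Low levels are controlled by the first moment and high levels by the weak cubic bound. The two
    estimates stay separate because they are later used with different cuts [K0] and [K1]. *)
Lemma low_levels (x : R) : 0 <= x ->
  \sum_(1 <= k < M.+1 | k%:R <= x) 2 * k%:R * #|` level k|%:R <= 2 * x * U.
Proof.
move=> x0; apply: le_trans (ler_wpM2l (mulr_ge0 (ler0n _ 2) x0) sum_r_le).
rewrite -sum_level mulr_sumr big_mkcond /=; apply: ler_sum => k _.
case: ifP => [kx|_]; last by rewrite !mulr_ge0.
by rewrite ler_wpM2r // ler_wpM2l.
Qed.

Lemma high_levels (x : R) : 0 < x ->
  \sum_(1 <= k < M.+1 | x < k%:R) 2 * k%:R * #|` level k|%:R <= 4 * V / x.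
Proof.
move=> x0; apply: (@le_trans _ _ (2 * V * \sum_(1 <= k < M.+1 | x < k%:R) k%:R ^- 2)).
  rewrite mulr_sumr [leLHS]big_nat_cond [leRHS]big_nat_cond.
  apply: ler_sum => k /andP[/andP[k0 _] _].
  have k0' : 0 < k%:R :> R by rewrite ltr0n.
  rewrite ler_pdivlMr ?exprn_gt0 //.
  by have := level_le k0; lra.
have := ler_wpM2l (mulr_ge0 (ler0n _ 2) weak_ge0) (sum_invsq_tail M x0).
by move/le_trans; apply; rewrite le_eqVlt; apply/orP; left; apply/eqP; ring.
Qed.

Lemma weak_sum_sqr (x : R) : 0 < x ->
  \sum_(z <- Z) (r z)%:R ^+ 2 <= 2 * x * U + 4 * V / x.
Proof.
move=> x0; apply: le_trans sum_sqr_le _.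
rewrite (bigID (fun k : nat => k%:R <= x)) /=.
apply: lerD; first exact: low_levels (ltW x0).
under eq_bigl do rewrite -ltNge.
exact: high_levels.
Qed.

Lemma weak_sum_sqr_sqr : 0 < U -> 0 < V ->
  (\sum_(z <- Z) (r z)%:R ^+ 2) ^+ 2 <= 36 * (U * V).
Proof.
(* This cut balances the two terms up to a constant: they become [2 sqrt(U V)] and [4 sqrt(U V)],
   hence [36 = 6^2]. *)
move=> U0 V0; pose x := Num.sqrt (V / U).
have x0 : 0 < x by rewrite sqrtr_gt0 divr_gt0.
have x2 : x ^+ 2 = V / U by rewrite sqr_sqrtr // divr_ge0 // ltW.
have E : 36 * (U * V) = (2 * x * U + 4 * V / x) ^+ 2.
  have -> : V = x ^+ 2 * U by rewrite x2 divfK // gt_eqF.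
  by field; rewrite gt_eqF.
rewrite E; apply: lerXn2r; last exact: weak_sum_sqr.
  by rewrite nnegrE sumr_ge0 // => z _; rewrite exprn_ge0.
by move: x0 U0 V0 => /ltW ? /ltW ? /ltW ?; rewrite nnegrE addr_ge0 ?divr_ge0 ?mulr_ge0.
Qed.

(** The third moment is critical for a weak cubic bound: every [k] may contribute [3 V / k]. This
    harmonic sum is the source of the logarithmic factor in the final bound. *)
Lemma weak_sum_cube :
  \sum_(z <- Z) (r z)%:R ^+ 3 <= 6 * V * ln M.+1%:R.
Proof.
apply: le_trans sum_cube_le _.
apply: (@le_trans _ _ (3 * V * \sum_(1 <= k < M.+1) k%:R ^-1)).
  rewrite mulr_sumr; apply: ler_sum_nat => k /andP[k0 _].
  have k0' : 0 < k%:R :> R by rewrite ltr0n.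
  rewrite ler_pdivlMr //.
  by have := level_le k0; lra.
have := ler_wpM2l (mulr_ge0 (ler0n _ 3) weak_ge0) (sum_inv_le R M).
by move/le_trans; apply; rewrite le_eqVlt; apply/orP; left; apply/eqP; ring.
Qed.

End LayerCake.

(** * Szemerédi-Trotter type as a bound for level sets *)

Section SzT.
Variables (R : realType).
Implicit Types (A B D Z : {fset R}) (alpha c : R).

Lemma conv_fsetE A B x : conv_fset A B x = (rep A B x)%:R.
Proof.
rewrite /conv_fset /conv -(@fsbig_widen _ _ _ _ [set` A]%classic) //=.
  rewrite -fsbig_seq ?fset_uniq // natr_sum; apply: eq_big_seq => a aA.
  by rewrite !indicE !mem_setE aA mul1r.
move=> y [_ /= /negP yA]; rewrite indicE mem_setE (negbTE yA); exact: mul0r.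
Qed.

(** A point with a positive number of representations lies in [sumset A B], so the level sets may be
    taken inside any [Z]. *)
Lemma SzT_rep (C0 : R) A alpha c B Z (k : nat) : SzT_type C0 A alpha c -> (0 < k)%N ->
  #|` level Z (rep A B) k|%:R * k%:R ^+ 3 <= C0 * c * #|` B|%:R `^ alpha.
Proof.
move=> [_ _ SzT] k0; have k0' : 0 < k%:R :> R by rewrite ltr0n.
rewrite -ler_pdivlMr ?exprn_gt0 //.
have := SzT B k%:R; rewrite ler1n !mulrA => /(_ k0); apply: le_trans.
rewrite ler_nat; apply: fsubset_leq_card; apply/fsubsetP => z.
rewrite !inE /= conv_fsetE ler_nat => /andP[_ kz]; rewrite kz andbT.
have : (0 < rep A B z)%N by apply: leq_trans kz.
rewrite lt0n sum_nat_seq_neq0 => /hasP[a aA /=]; rewrite eqb0 negbK => bB.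
by rewrite -(subrK a z) addrC mem_sumset.
Qed.

Lemma SzT_dif (C0 : R) A alpha c B Z (k : nat) : SzT_type C0 A alpha c -> (0 < k)%N ->
  #|` level Z (dif A B) k|%:R * k%:R ^+ 3 <= C0 * c * #|` B|%:R `^ alpha.
Proof.
move=> SzT k0; rewrite -(card_oppset B).
have := SzT_rep (oppset B) Z SzT k0; congr (_%:R * _ <= _).
by congr (size (enum_fset _)); apply/fsetP => z; rewrite !inE /= rep_oppset.
Qed.

End SzT.

(** * The level sets of the representation function of differences *)

Section LevelBound.
Variables (R : realType) (C0 : R) (A : {fset R}) (alpha c : R).
Hypotheses (C0_gt0 : 0 < C0) (A_gt1 : (1 < #|` A|)%N).
Hypothesis A_SzT : SzT_type C0 A alpha c.

Let S := sumset A A.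
Let c_gt0 : 0 < c. Proof. by case: A_SzT. Qed.
Let A_gt0 : (0 < #|` A|)%N. Proof. exact: ltnW. Qed.
Let S_gt0 : (0 < #|` S|)%N. Proof. exact: leq_trans (card_sumset_ge A). Qed.

Lemma ln_leB1 (x : R) : 0 < x -> ln x <= x - 1.
Proof.
move=> x0; rewrite -[in leLHS](subrK 1 x) addrC le_ln1Dx //.
by rewrite ltrBrDr addNr.
Qed.

Lemma ler_ln_pos (x y : R) : 0 < x -> x <= y -> ln x <= ln y.
Proof. by move=> x0 xy; rewrite ler_ln ?posrE // (lt_le_trans x0). Qed.

Lemma lnX (x : R) (n : nat) : 0 < x -> ln (x ^+ n) = n%:R * ln x.
Proof. by move=> x0; rewrite lnXn // mulr_natl. Qed.

Lemma dif_le_r (B D : {fset R}) x : (dif B D x <= #|` D|)%N.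
Proof. by rewrite -sum1_fset; apply: leq_sum => b _; case: (_ \in _). Qed.

(** By reflection, [dif D A] at [z] is [dif A D] at [- z], so the hypothesis on [A] also applies
    when [A] is the set being subtracted. *)
Lemma SzT_dif_l (D Z : {fset R}) (k : nat) : (0 < k)%N ->
  #|` level Z (dif D A) k|%:R * k%:R ^+ 3 <= C0 * c * #|` D|%:R `^ alpha.
Proof.
move=> k0; apply: le_trans (SzT_dif D (oppset Z) A_SzT k0).
rewrite ler_wpM2r ?exprn_ge0 // ler_nat -(card_oppset (level _ _ _)).
apply: fsubset_leq_card; apply/fsubsetP => z /imfsetP[x /=].
rewrite !inE /= => /andP[xZ kx] ->; rewrite -dif_opp kx andbT.
by apply/imfsetP; exists x.
Qed.

(* The logarithm of the sixth power of the Cauchy-Schwarz bound for triples; the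
   sixth power clears the cube root from Hölder and the square root in G2.  Here and below
   numerical constants come from [ln x <= x - 1]; their size is irrelevant. *)
Lemma ln_level (Z : {fset R}) (k : nat) : (0 < k)%N ->
  let D := level Z (dif (rich A) (rich A)) k in (0 < #|` D|)%N ->
  12 * ln k%:R + (9 - alpha) * ln #|` D|%:R <=
  111 + 9 * ln C0 + 9 * ln c + (6 * alpha - 21) * ln #|` A|%:R
    + 8 * ln (ln #|` A|.+1%:R) + (6 + 2 * alpha) * ln #|` S|%:R :> R.
Proof.
move=> k0 D D0.
have lnA1 : 0 < ln #|` A|.+1%:R :> R by rewrite ln_gt0 // ltr1n ltnS.
pose m := popular_pairs A D.
pose E3 := (\sum_(z <- diffset A A) dif A A z ^ 3)%N.
pose Q := (\sum_(z <- diffset A S) dif A S z * dif D A z)%N.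
have H1 : ((#|` A| * (k * #|` D|)) ^ 2 <= 4 * (m * E3))%N.
  apply: leq_trans (rich_triples A D); rewrite leq_exp2r // leq_mul2l.
  apply/orP; right; rewrite mulnC -sum1_fset big_distrl /=.
  by apply: leq_sum_seq => x; rewrite !inE /= mul1n => /andP[].
have H2 : (#|` A| ^ 2 * m <= 4 * #|` S| * Q)%N by exact: popular_pairs_le.
(* A nonempty [D] forces all the counts in the chain to be positive, so that logarithms may be
   taken. *)
have mE : (0 < m * E3)%N.
  rewrite -(@ltn_pmul2l 4) // muln0; apply: leq_trans H1.
  by rewrite expn_gt0 !muln_gt0 A_gt0 k0 D0.
have m0 : (0 < m)%N by move: mE; rewrite muln_gt0 => /andP[].
have E0 : (0 < E3)%N by move: mE; rewrite muln_gt0 => /andP[].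
have Q0 : (0 < Q)%N.
  have : (0 < 4 * #|` S| * Q)%N.
    by apply: leq_trans H2; rewrite muln_gt0 expn_gt0 A_gt0 m0.
  by rewrite muln_gt0 => /andP[].
pose F3 : R := \sum_(z <- diffset A S) (dif A S z)%:R ^+ 3.
pose G1 : R := \sum_(z <- diffset A S) (dif D A z)%:R.
pose G2 : R := \sum_(z <- diffset A S) (dif D A z)%:R ^+ 2.
have H3 : Q%:R ^+ 3 <= F3 * G1 * G2.
  rewrite /Q natr_sum; under eq_bigr do rewrite natrM.
  exact: hoelder3.
have FGG : 0 < F3 * G1 * G2 by apply: lt_le_trans H3; rewrite exprn_gt0 ?ltr0n.
have F3_ge0 : 0 <= F3 by apply: sumr_ge0 => z _; rewrite exprn_ge0.
have G1_ge0 : 0 <= G1 by exact: sumr_ge0.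
have G2_ge0 : 0 <= G2 by apply: sumr_ge0 => z _; rewrite exprn_ge0.
have [F3_gt0 G1_gt0 G2_gt0] : [/\ 0 < F3, 0 < G1 & 0 < G2].
  rewrite !lt0r F3_ge0 G1_ge0 G2_ge0 !andbT.
  by move: FGG; rewrite lt0r !mulf_eq0 !negb_or => /andP[/andP[/andP[-> ->] ->] _].
have rpow (B : {fset R}) : (0 < #|` B|)%N -> 0 < #|` B|%:R `^ alpha :> R.
  by move=> B0; rewrite powR_gt0 // ltr0n.
have lnV (B : {fset R}) : (0 < #|` B|)%N ->
    ln (C0 * c * #|` B|%:R `^ alpha) = ln C0 + ln c + alpha * ln #|` B|%:R.
  by move=> B0; rewrite !lnM ?ln_powR // posrE ?mulr_gt0 ?rpow.
have H4 : E3%:R <= 6 * (C0 * c * #|` A|%:R `^ alpha) * ln #|` A|.+1%:R.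
  rewrite natr_sum; under eq_bigr do rewrite natrX.
  apply: weak_sum_cube => [z|j j0]; first exact: dif_le.
  exact: SzT_dif A_SzT j0.
have H5 : F3 <= 6 * (C0 * c * #|` S|%:R `^ alpha) * ln #|` A|.+1%:R.
  apply: weak_sum_cube => [z|j j0]; first exact: dif_le.
  exact: SzT_dif A_SzT j0.
have H6 : G1 <= #|` A|%:R * #|` D|%:R.
  by rewrite /G1 -natr_sum -natrM ler_nat mulnC sum_dif_le.
have H7 : G2 ^+ 2 <= 36 * (#|` A|%:R * #|` D|%:R * (C0 * c * #|` D|%:R `^ alpha)).
  apply: (@weak_sum_sqr_sqr _ _ _ _ #|` A|) => //.
  - by move=> z; exact: dif_le_r.
  - by move=> j j0; exact: SzT_dif_l.
  - by rewrite mulr_gt0 ?ltr0n.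
  - by rewrite !mulr_gt0 ?rpow.
have ln4 : ln 4 <= 4 - 1 :> R by exact: ln_leB1.
have ln6 : ln 6 <= 6 - 1 :> R by exact: ln_leB1.
have ln36 : ln 36 <= 36 - 1 :> R by exact: ln_leB1.
have P (n : nat) : (0 < n)%N -> (n%:R : R) \is Num.pos by rewrite posrE ltr0n.
have V_gt0 (B : {fset R}) : (0 < #|` B|)%N -> C0 * c * #|` B|%:R `^ alpha \is Num.pos.
  by move=> B0; rewrite posrE !mulr_gt0 ?rpow.
have {}H1 : 2 * (ln #|` A|%:R + (ln k%:R + ln #|` D|%:R)) <= ln 4 + (ln m%:R + ln E3%:R) :> R.
  have := @ler_ln_pos ((#|` A| * (k * #|` D|)) ^ 2)%N%:R (4 * (m * E3))%N%:R.
  rewrite ler_nat ltr0n expn_gt0 !muln_gt0 A_gt0 k0 D0 => /(_ isT H1).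
  rewrite natrX lnX ?ltr0n ?muln_gt0 ?A_gt0 ?k0 //.
  by rewrite !natrM !lnM ?posrE ?mulr_gt0 ?ltr0n.
have {}H2 : 2 * ln #|` A|%:R + ln m%:R <= ln 4 + ln #|` S|%:R + ln Q%:R :> R.
  have := @ler_ln_pos (#|` A| ^ 2 * m)%N%:R (4 * #|` S| * Q)%N%:R.
  rewrite ler_nat ltr0n muln_gt0 expn_gt0 A_gt0 m0 => /(_ isT H2).
  rewrite natrM natrX !natrM lnM ?posrE ?exprn_gt0 ?ltr0n // lnX ?ltr0n //.
  by rewrite lnM ?posrE ?mulr_gt0 ?ltr0n // lnM ?posrE ?ltr0n.
have {}H3 : 3 * ln Q%:R <= ln F3 + ln G1 + ln G2.
  have := ler_ln_pos _ H3; rewrite exprn_gt0 ?ltr0n // => /(_ isT).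
  by rewrite lnX ?ltr0n // !lnM ?posrE ?mulr_gt0.
have {}H4 : ln E3%:R <= ln 6 + (ln C0 + ln c + alpha * ln #|` A|%:R) + ln (ln #|` A|.+1%:R) :> R.
  have := ler_ln_pos _ H4; rewrite ltr0n => /(_ E0); rewrite lnM ?posrE // ?mulr_gt0 ?rpow //.
  by rewrite lnM ?V_gt0 ?posrE // lnV.
have {}H5 : ln F3 <= ln 6 + (ln C0 + ln c + alpha * ln #|` S|%:R) + ln (ln #|` A|.+1%:R) :> R.
  have := ler_ln_pos F3_gt0 H5; rewrite lnM ?posrE // ?mulr_gt0 ?rpow //.
  by rewrite lnM ?V_gt0 ?posrE // lnV.
have {}H6 : ln G1 <= ln #|` A|%:R + ln #|` D|%:R.
  by have := ler_ln_pos G1_gt0 H6; rewrite lnM ?P.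
have {}H7 : 2 * ln G2 <= ln 36 + (ln #|` A|%:R + ln #|` D|%:R +
    (ln C0 + ln c + alpha * ln #|` D|%:R)).
  have := ler_ln_pos _ H7; rewrite exprn_gt0 // => /(_ isT).
  rewrite lnX // lnM ?posrE // ?mulr_gt0 ?rpow ?ltr0n //.
  by rewrite lnM ?V_gt0 ?posrE ?mulr_gt0 ?ltr0n // lnM ?P // lnV.
(* [H1] to [H7] are added with weights 6, 6, 2, 6, 2, 2, 1; the numerical constants give
   [12 * 3 + 8 * 5 + 35 = 111]. *)
lra.
Qed.

End LevelBound.

(** * Bounds for the doubling constant *)

Section Doubling.
Variables (R : realType) (C0 : R) (A : {fset R}) (alpha c : R).
Hypotheses (C0_ge1 : 1 <= C0) (A_gt1 : (1 < #|` A|)%N).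
Hypothesis A_SzT : SzT_type C0 A alpha c.

Let S := sumset A A.
Let n : R := ln #|` A|%:R.
Let s : R := ln #|` S|%:R.
Let e : R := ln c.
Let c0 : R := ln C0.
Let lam : R := ln (ln #|` A|.+1%:R).
Let C0_gt0 : 0 < C0. Proof. exact: lt_le_trans C0_ge1. Qed.
Let alpha_ge1 : 1 <= alpha. Proof. by case: A_SzT. Qed.
Let c_gt0 : 0 < c. Proof. by case: A_SzT. Qed.
Let A_gt0 : (0 < #|` A|)%N. Proof. exact: ltnW. Qed.
Let S_gt0 : (0 < #|` S|)%N. Proof. exact: leq_trans (card_sumset_ge A). Qed.

(** The hypothesis is tested on [B = {0}] with [tau = 1]. The resulting lower bound for [c] settles
    the range [alpha > 3]. *)
Lemma ln_SzT_const : n <= c0 + e.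
Proof.
have := SzT_dif [fset 0]%fset A A_SzT (ltn0Sn 0).
rewrite cardfs1 powR1 expr1n !mulr1.
have -> : level A (dif A [fset 0]%fset) 1 = A.
  apply/fsetP => a; rewrite !inE /=; case aA : (a \in A) => //=.
  by rewrite /dif big_seq_fset1 addr0 aA.
move/ler_ln_pos; rewrite ltr0n => /(_ A_gt0).
by rewrite lnM ?posrE.
Qed.

Let A1 := rich A.
Let Z := diffset A1 A1.
Let r := dif A1 A1.
Let d (k : nat) : R := #|` level Z r k|%:R.
Let K1 : R := 256 * (C0 * c * #|` A|%:R `^ alpha) * #|` S|%:R / #|` A|%:R ^+ 4.
Let K0 : R := #|` A|%:R ^+ 2 / (128 * #|` S|%:R).

Let N_gt0 : 0 < #|` A|%:R :> R. Proof. by rewrite ltr0n. Qed.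
Let Sr_gt0 : 0 < #|` S|%:R :> R. Proof. by rewrite ltr0n. Qed.
Let V_gt0 : 0 < C0 * c * #|` A|%:R `^ alpha.
Proof. by rewrite !mulr_gt0 ?powR_gt0. Qed.
Let K1_gt0 : 0 < K1. Proof. by rewrite /K1 divr_gt0 ?mulr_gt0 ?powR_gt0 ?exprn_gt0. Qed.
Let K0_gt0 : 0 < K0. Proof. by rewrite /K0 divr_gt0 ?mulr_gt0 ?exprn_gt0. Qed.

Lemma ln_K1 : ln K1 = ln 256 + c0 + e + alpha * n + s - 4 * n.
Proof.
rewrite /K1 ln_div ?posrE ?exprn_gt0 ?mulr_gt0 ?powR_gt0 //.
by rewrite lnX // !lnM ?posrE ?mulr_gt0 ?powR_gt0 // ln_powR !addrA.
Qed.

Lemma ln_K0 : ln K0 = 2 * n - (ln 128 + s).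
Proof.
by rewrite /K0 ln_div ?posrE ?exprn_gt0 ?mulr_gt0 // lnX // lnM ?posrE.
Qed.

(* K0 and K1 are chosen so that the levels outside ]K0, K1] carry at most half of
   the energy, which is at least N^4 / (16 |S|). *)
Lemma energy_middle : #|` A|%:R ^+ 4 / (32 * #|` S|%:R) <=
  \sum_(1 <= k < #|` A|.+1 | K0 < k%:R <= K1) 2 * k%:R * d k.
Proof.
(* The factor 16 is [2^4], from [|A| <= 2 |A1|]. *)
have energy : #|` A|%:R ^+ 4 <= 16 * #|` S|%:R * \sum_(z <- Z) (r z)%:R ^+ 2 :> R.
  have h : (#|` A| ^ 4 <= 16 * #|` S| * \sum_(z <- Z) r z ^ 2)%N.
    apply: (@leq_trans ((2 * #|` A1|) ^ 4)); first by rewrite leq_exp2r // card_rich.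
    rewrite expnMn -mulnA leq_mul2l; apply/orP; right.
    apply: energy_ge => a b /rich_sub aA /rich_sub bA; exact: mem_sumset.
  have := h; rewrite -(ler_nat R) natrX !natrM natr_sum.
  by under [X in _ * X]eq_bigr do rewrite natrX.
have r_le z : (r z <= #|` A|)%N.
  apply: leq_trans (dif_le _ _ _) _; apply: fsubset_leq_card.
  by apply/fsubsetP; exact: rich_sub.
have sum_r : \sum_(z <- Z) (r z)%:R <= #|` A|%:R ^+ 2 :> R.
  rewrite -natr_sum -natrX ler_nat; apply: leq_trans (sum_dif_le _ _ _) _.
  rewrite -mulnn; apply: leq_mul; apply: fsubset_leq_card; apply/fsubsetP; exact: rich_sub.
(* As [rich A] is contained in [A], its differences inherit the weak cubic bound from those of
   [A]. *)
have r_dif z : (r z <= dif A A z)%N.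
  apply: (@leq_trans (\sum_(b <- A1) ((z + b)%R \in A))).
    apply: leq_sum => b _; case h : (_ \in A1) => //.
    by rewrite (rich_sub h).
  by apply: leq_sum_sub; rewrite ?fset_uniq //; exact: rich_sub.
have level_r (k : nat) : (0 < k)%N -> d k * k%:R ^+ 3 <= C0 * c * #|` A|%:R `^ alpha.
  move=> k0; apply: le_trans (SzT_dif A Z A_SzT k0).
  rewrite ler_wpM2r ?exprn_ge0 // ler_nat; apply: fsubset_leq_card.
  apply/fsubsetP => z; rewrite !inE /= => /andP[-> kz] /=.
  exact: leq_trans (r_dif z).
have low := low_levels r_le sum_r (ltW K0_gt0).
have high := high_levels #|` A| level_r K1_gt0.
have tot := sum_sqr_le R Z r_le.
pose F k := 2 * k%:R * d k.
have F_ge0 k : 0 <= F k by rewrite !mulr_ge0.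
have split3 : \sum_(1 <= k < #|` A|.+1) F k <=
    \sum_(1 <= k < #|` A|.+1 | k%:R <= K0) F k +
    \sum_(1 <= k < #|` A|.+1 | K1 < k%:R) F k +
    \sum_(1 <= k < #|` A|.+1 | K0 < k%:R <= K1) F k.
  rewrite [X in _ <= X + _ + _]big_mkcond [X in _ <= _ + X + _]big_mkcond.
  rewrite [X in _ <= _ + _ + X]big_mkcond -!big_split /=; apply: ler_sum => k _.
  have := F_ge0 k; case: (leP k%:R K0) => _; case: (leP k%:R K1) => _ /=; lra.
have lowE : 2 * K0 * #|` A|%:R ^+ 2 = #|` A|%:R ^+ 4 / (64 * #|` S|%:R).
  by rewrite /K0; field; rewrite gt_eqF.
have highE : 4 * (C0 * c * #|` A|%:R `^ alpha) / K1 = #|` A|%:R ^+ 4 / (64 * #|` S|%:R).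
  rewrite /K1; move: V_gt0 Sr_gt0 N_gt0.
  move: (C0 * c * _) => v v0 s0 n0.
  by field; rewrite !gt_eqF.
have {}energy : #|` A|%:R ^+ 4 / (16 * #|` S|%:R) <= \sum_(z <- Z) (r z)%:R ^+ 2 :> R.
  by rewrite ler_pdivrMr ?mulr_gt0 // mulrC.
have E16 : #|` A|%:R ^+ 4 / (16 * #|` S|%:R) = 2 * (#|` A|%:R ^+ 4 / (32 * #|` S|%:R)) :> R.
  by field; rewrite gt_eqF.
have E64 : #|` A|%:R ^+ 4 / (32 * #|` S|%:R) = 2 * (#|` A|%:R ^+ 4 / (64 * #|` S|%:R)) :> R.
  by field; rewrite gt_eqF.
rewrite lowE in low; rewrite highE in high.
rewrite -/(F _) in split3 *.
move: (le_trans energy tot) split3 low high; rewrite /F /d.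
lra.
Qed.

(** In the middle range [k^2 d k] is at most [expR om], so the energy there is bounded by [expR om]
    times a harmonic sum over []K0, K1]]. Comparison with [energy_middle] and logarithms give the
    claim. *)
Lemma ln_doubling : alpha <= 3 ->
  (9 - alpha) * (4 * n - s - 1023 - (1 + ln K1 - ln K0) / 8) <=
  111 + 9 * c0 + 9 * e + (6 * alpha - 21) * n + 8 * lam + (6 + 2 * alpha) * s
  + (6 - 2 * alpha) * ln K1.
Proof.
move=> alpha_le3.
set Lam := 111 + 9 * c0 + 9 * e + (6 * alpha - 21) * n + 8 * lam + (6 + 2 * alpha) * s.
(* [om] is to bound [2 ln k + ln (d k)]. Multiplied by [9 - alpha], this exceeds the left side of
   [ln_level] by [(6 - 2 alpha) ln k], which [k <= K1] and [alpha <= 3] control. *)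
pose om := (Lam + (6 - 2 * alpha) * ln K1) / (9 - alpha).
have beta0 : 0 < 9 - alpha by lra.
suff : 4 * n - s - 1023 - (1 + ln K1 - ln K0) / 8 <= om.
  by rewrite /om ler_pdivlMr // mulrC.
have level_om k : (0 < k)%N -> k%:R <= K1 -> 2 * k%:R * d k <= 2 * expR om * k%:R^-1.
  move=> k0 kK; have k0' : 0 < k%:R :> R by rewrite ltr0n.
  rewrite -!mulrA ler_pM2l // ler_pdivlMr //.
  have [D0|D0] := posnP #|` level Z r k|.
    by rewrite /d D0 mulr0 mul0r expR_ge0.
  have D0' : 0 < d k by rewrite /d ltr0n.
  rewrite -ler_ln ?posrE ?mulr_gt0 ?expR_gt0 // expRK.
  rewrite !lnM ?posrE ?mulr_gt0 // /om ler_pdivlMr //.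
  have := ln_level C0_gt0 A_gt1 A_SzT k0 D0; rewrite -/(d k).
  have := ler_wpM2l (_ : 0 <= 6 - 2 * alpha) (ler_ln_pos k0' kK).
  rewrite -/n -/s -/e -/c0 -/lam => /(_ ltac:(lra)).
  rewrite /Lam; lra.
have sum_om : #|` A|%:R ^+ 4 / (32 * #|` S|%:R) <=
    2 * expR om * \sum_(1 <= k < #|` A|.+1 | K0 < k%:R <= K1) k%:R^-1.
  apply: le_trans energy_middle _; rewrite mulr_sumr.
  rewrite [leLHS]big_nat_cond [leRHS]big_nat_cond.
  by apply: ler_sum => k /andP[/andP[k0 _] /andP[_ kK]]; exact: level_om.
have lhs_gt0 : 0 < #|` A|%:R ^+ 4 / (32 * #|` S|%:R) :> R.
  by rewrite divr_gt0 ?mulr_gt0 ?exprn_gt0.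
(* The middle sum is positive, so some integer [k >= 1] lies in the range; this gives both
   inequalities, and the second yields [K1 + 1 <= 2 K1]. *)
have [K01 K1_ge1] : K0 <= K1 /\ 1 <= K1.
  have [k /andP[k0 /andP[kK0 kK1]]] : exists k : nat, (0 < k)%N && (K0 < k%:R <= K1).
    apply: contrapT => nk; move: sum_om; rewrite big_nat_cond big_pred0.
      by rewrite mulr0 leNgt lhs_gt0.
    move=> k; apply/negP => /andP[/andP[k0 _] kK]; apply: nk.
    by exists k; rewrite k0.
  by split; [exact: ltW (lt_le_trans kK0 kK1) | apply: le_trans kK1; rewrite ler1n].
pose y := 2 * K1 / K0.
have y_gt0 : 0 < y by rewrite /y divr_gt0 // mulr_gt0.
have ln_y : ln y = ln 2 + ln K1 - ln K0.
  have K2 : 0 < 2 * K1 by rewrite mulr_gt0.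
  by rewrite /y (@ln_div _ (2 * K1) K0) ?posrE // (@lnM _ 2 K1) ?posrE.
(* Since [ln y = 8 ln (y^(1/8)) <= 8 y^(1/8)], the length of the range is paid for by a small power
   of [K1 / K0] and not by a further logarithm. *)
have ln_le : 2 * (ln (K1 + 1) - ln K0) <= 16 * y `^ 8^-1.
  have h : ln (K1 + 1) <= ln (2 * K1) by apply: ler_ln_pos; lra.
  have := ln_leB1 (powR_gt0 8^-1 y_gt0); rewrite ln_powR ln_y.
  by move: h; rewrite (@lnM _ 2 K1) ?posrE //; lra.
have {}sum_om : #|` A|%:R ^+ 4 / (32 * #|` S|%:R) <= 2 * expR om * (16 * y `^ 8^-1).
  apply: le_trans sum_om _; rewrite ler_wpM2l ?mulr_ge0 ?expR_ge0 //.
  exact: le_trans (sum_inv_range _ K0_gt0 K01) ln_le.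
have {}sum_om : #|` A|%:R ^+ 4 <= 1024 * expR om * y `^ 8^-1 * #|` S|%:R.
  move: sum_om; rewrite ler_pdivrMr ?mulr_gt0 //.
  by move/le_trans; apply; rewrite le_eqVlt; apply/orP; left; apply/eqP; ring.
have := ler_ln_pos _ sum_om; rewrite exprn_gt0 // => /(_ isT).
have y8_gt0 : 0 < y `^ 8^-1 by exact: powR_gt0.
have om_gt0 : 0 < expR om by exact: expR_gt0.
have om1_gt0 : 0 < 1024 * expR om by rewrite mulr_gt0.
have omy_gt0 : 0 < 1024 * expR om * y `^ 8^-1 by exact: mulr_gt0.
rewrite (@lnM _ (1024 * expR om * y `^ 8^-1)) ?posrE //.
rewrite (@lnM _ (1024 * expR om)) ?posrE // (@lnM _ 1024) ?posrE //.
rewrite expRK ln_powR ln_y lnX //.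
have ln2 : ln 2 <= 2 - 1 :> R by exact: ln_leB1.
have ln1024 : ln 1024 <= 1024 - 1 :> R by exact: ln_leB1.
rewrite -/n -/s; lra.
Qed.

(** With [d = |A|^(4 - alpha) / c] and [K = |S| / |A|], up to constants [K1] is [|S| / d] and
    [K1 / K0] is [K^2 / d]. After substitution [n] and [s] survive only through [ln d] and
    [ln K]. *)
Lemma ln_doubling_exponents : alpha <= 3 ->
  (15 - 2 * alpha + (9 - alpha) / 8) * ((4 - alpha) * n - e) <=
  (21 - alpha + (9 - alpha) / 4) * (s - n) + 8 * lam + 9900 * (1 + c0).
Proof.
move=> alpha_le3.
have ln256 : ln 256 <= 256 - 1 :> R by exact: ln_leB1.
have ln128 : ln 128 <= 128 - 1 :> R by exact: ln_leB1.
have c0_ge0 : 0 <= c0 by exact: ln_ge0.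
have K1_le : ln K1 <= 255 + c0 + e + alpha * n + s - 4 * n by rewrite ln_K1; lra.
have K10_le : ln K1 - ln K0 <= 382 + c0 + e + alpha * n + 2 * s - 6 * n.
  by rewrite ln_K0; lra.
have b6 : 0 <= 6 - 2 * alpha by lra.
have b9 : 0 <= 9 - alpha by lra.
have a1 : 0 <= alpha - 1 by rewrite subr_ge0.
have := ler_wpM2l b6 K1_le; have := ler_wpM2l b9 K10_le; have := mulr_ge0 a1 c0_ge0.
have := ln_doubling alpha_le3.
move: (ln K1) (ln K0) => x1 x0.
lra.
Qed.

End Doubling.

(** * Comparison of the exponents *)

Section Exponents.
Variable R : realFieldType.
Implicit Types (a k l d M : R).

(* The hypothesis is multiplied by (11 a - 1) / (15 - 2 a + (9 - a) / 8), which
   makes the coefficients of d agree. *)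
Lemma optimize_exponents a k l d M : 1 <= a -> a <= 3 -> 0 <= k -> 0 <= l -> 0 <= M ->
  (15 - 2 * a + (9 - a) / 8) * d <= (21 - a + (9 - a) / 4) * k + 8 * l + M ->
  (11 * a - 1) * d <= (3 * a ^+ 2 + 12 * a + 1) * (k + M) + 4 * (3 * a - 1) * l.
Proof.
move=> a1 a3 k0 l0 M0 H.
set p := 15 - 2 * a + (9 - a) / 8 in H *.
have p_ge1 : 1 <= p by rewrite /p; lra.
have p_gt0 : 0 < p by lra.
rewrite -(ler_pM2l p_gt0).
have H1 : (11 * a - 1) * (p * d) <=
    (11 * a - 1) * ((21 - a + (9 - a) / 4) * k + 8 * l + M) by rewrite ler_wpM2l //; lra.
(* The gap between the exponents vanishes at [a = 3]; the remaining quadratic [51 a^2 - 140 a + 105]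
   has negative discriminant, whence the completed square. *)
have Hk : 0 <= (p * (3 * a ^+ 2 + 12 * a + 1) - (11 * a - 1) * (21 - a + (9 - a) / 4)) * k.
  rewrite mulr_ge0 //.
  have -> : p * (3 * a ^+ 2 + 12 * a + 1) - (11 * a - 1) * (21 - a + (9 - a) / 4) =
     (3 - a) * (51 * (a - 70 / 51) ^+ 2 + 455 / 51) / 8 by rewrite /p; field.
  have := sqr_ge0 (a - 70 / 51); move: (_ ^+ 2) => u u0.
  by rewrite divr_ge0 // mulr_ge0 //; lra.
have Hl : 0 <= (4 * (3 * a - 1) * p - 8 * (11 * a - 1)) * l.
  rewrite mulr_ge0 //.
  have -> : 4 * (3 * a - 1) * p - 8 * (11 * a - 1) =
     4 * (6 * ((a - 1) * (3 - a)) + a + 5 + (3 * a - 1) * ((9 - a) / 8)).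
    by rewrite /p; field.
  have : 0 <= (a - 1) * (3 - a) by apply: mulr_ge0; lra.
  have : 0 <= (3 * a - 1) * ((9 - a) / 8) by apply: mulr_ge0; lra.
  by lra.
have HM : 0 <= (p * (3 * a ^+ 2 + 12 * a + 1) - (11 * a - 1)) * M.
  rewrite mulr_ge0 //.
  have a2 := sqr_ge0 a.
  have : 0 <= (p - 1) * (3 * a ^+ 2 + 12 * a + 1) by apply: mulr_ge0; lra.
  by lra.
by lra.
Qed.

End Exponents.

(** * The lower bound for the sumset, in logarithmic and in multiplicative form *)

Lemma ln_sumset_ge (R : realType) (C0 : R) (A : {fset R}) (alpha c : R) :
  1 <= C0 -> (1 < #|` A|)%N -> SzT_type C0 A alpha c ->
  (11 * alpha - 1) * ((4 - alpha) * ln #|` A|%:R - ln c) <=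
  (3 * alpha ^+ 2 + 12 * alpha + 1) *
    (ln #|` sumset A A|%:R - ln #|` A|%:R + 10000 * (1 + ln C0))
  + 4 * (3 * alpha - 1) * ln (log2 #|` A|%:R).
Proof.
move=> C0_ge1 A1 SzT; have C0_gt0 : 0 < C0 by lra.
have alpha_ge1 : 1 <= alpha by case: SzT.
have A0 : (0 < #|` A|)%N by exact: ltnW.
have c0 : 0 <= ln C0 by exact: ln_ge0.
have ln2_gt0 : 0 < ln 2 :> R by rewrite ln_gt0 // ltr1n.
have ln2_le1 : ln 2 <= 2 - 1 :> R by exact: ln_leB1.
have n0 : ln 2 <= ln #|` A|%:R :> R by apply: ler_ln_pos => //; rewrite ler_nat.
have log2_ge1 : 1 <= log2 #|` A|%:R :> R by rewrite /log2 ler_pdivlMr // mul1r.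
have l0 : 0 <= ln (log2 #|` A|%:R) :> R by exact: ln_ge0.
have k0 : 0 <= ln #|` sumset A A|%:R - ln #|` A|%:R :> R.
  by rewrite subr_ge0; apply: ler_ln_pos; rewrite ?ltr0n // ler_nat card_sumset_ge.
have eA := ln_SzT_const C0_ge1 A1 SzT.
(* For [alpha > 3], [|A|^(4 - alpha) / c] is at most [|A| / c <= C0], and the claim follows from
   [|A + A| >= |A|] and [log2 |A| >= 1]. *)
have [alpha_le3|alpha_gt3] := leP alpha 3; last first.
  have d_le : (4 - alpha) * ln #|` A|%:R - ln c <= ln C0.
    have : 0 <= (alpha - 3) * ln #|` A|%:R by apply: mulr_ge0; lra.
    by move: eA; lra.
  have := ler_wpM2l (_ : 0 <= 11 * alpha - 1) d_le => /(_ ltac:(lra)).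
  have q_ge : 0 <= 3 * alpha ^+ 2 + 12 * alpha + 1 - (11 * alpha - 1).
    by have := sqr_ge0 alpha; lra.
  have := mulr_ge0 q_ge c0.
  have q0 : 0 <= 3 * alpha ^+ 2 + 12 * alpha + 1 by lra.
  have := mulr_ge0 q0 c0; have := mulr_ge0 q0 k0.
  have : 0 <= (3 * alpha - 1) * ln (log2 #|` A|%:R) by apply: mulr_ge0 => //; lra.
  by lra.
apply: optimize_exponents => //; first by lra.
(* Passing to [log2 |A|] costs a factor 2, from [|A| + 1 <= |A|^2]. Its logarithm, taken 8 times, is
   absorbed in the step from 9900 to 10000. *)
have lam_le : ln (ln #|` A|.+1%:R) <= 1 + ln (log2 #|` A|%:R) :> R.
  have h : ln #|` A|.+1%:R <= 2 * log2 #|` A|%:R :> R.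
    apply: (@le_trans _ _ (2 * ln #|` A|%:R)).
      rewrite -lnX ?ltr0n // -natrX; apply: ler_ln_pos; rewrite ?ltr0n // ler_nat.
      by move: A1; rewrite -mulnn; nia.
    by rewrite ler_pM2l // /log2 ler_pdivlMr // ler_piMr; lra.
  have := ler_ln_pos _ h; rewrite ln_gt0 ?ltr1n ?ltnS // => /(_ isT).
  rewrite lnM ?posrE //; lra.
by have := ln_doubling_exponents C0_ge1 A1 SzT alpha_le3; lra.
Qed.

Lemma SzT_type_le (R : realType) (C0 C1 : R) (A : {fset R}) (alpha c : R) :
  C0 <= C1 -> SzT_type C0 A alpha c -> SzT_type C1 A alpha c.
Proof.
move=> C01 [a1 c0 SzT]; split=> // B tau tau1.
apply: le_trans (SzT B tau tau1) _; rewrite ler_wpM2r // mulr_ge0 //.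
  by rewrite mulr_ge0 ?powR_ge0 // ltW.
by rewrite invr_ge0 exprn_ge0 // (le_trans ler01).
Qed.

Lemma sumset_ge (R : realType) (C0 : R) : exists2 K : R, 0 < K &
  forall (A : {fset R}) (alpha c : R),
    (1 < #|` A|)%N ->
    SzT_type C0 A alpha c ->
    K * (c `^ ((1 - 11 * alpha) / (3 * alpha ^+ 2 + 12 * alpha + 1))
         * #|` A|%:R `^ ((- 8 * alpha ^+ 2 + 57 * alpha - 3)
                          / (3 * alpha ^+ 2 + 12 * alpha + 1))
         * log2 #|` A|%:R `^ (- (4 * (3 * alpha - 1)
                                 / (3 * alpha ^+ 2 + 12 * alpha + 1))))
    <= #|` sumset A A|%:R.
Proof.
(* Enlarging the constant preserves the type, and [C1 >= 1] makes [ln C1] nonnegative. *)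
pose C1 := Num.max 1 C0.
have C1_ge1 : 1 <= C1 by rewrite le_max lexx.
exists (expR (- (10000 * (1 + ln C1)))) => [|A alpha c A1 SzT]; first exact: expR_gt0.
have alpha_ge1 : 1 <= alpha by case: SzT.
have c_gt0 : 0 < c by case: SzT.
have A0 : 0 < #|` A|%:R :> R by rewrite ltr0n ltnW.
have S0 : 0 < #|` sumset A A|%:R :> R.
  by rewrite ltr0n (leq_trans _ (card_sumset_ge A)) // ltnW.
have L0 : 0 < log2 #|` A|%:R :> R by rewrite divr_gt0 ?ln_gt0 // ltr1n.
have C01 : C0 <= C1 by rewrite le_max lexx orbT.
have := ln_sumset_ge C1_ge1 A1 (SzT_type_le C01 SzT).
set q := 3 * alpha ^+ 2 + 12 * alpha + 1.
have q_gt0 : 0 < q by rewrite /q; have := sqr_ge0 alpha; lra.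
move: (10000 * _) => M H.
set x := (1 - _) / q; set y := (_ - 3) / q; set z := - (_ / q).
have c1 : 0 < c `^ x by exact: powR_gt0.
have A2 : 0 < #|` A|%:R `^ y :> R by exact: powR_gt0.
have L1 : 0 < log2 #|` A|%:R `^ z :> R by exact: powR_gt0.
have K0 : 0 < expR (- M) by exact: expR_gt0.
rewrite -ler_ln ?posrE ?mulr_gt0 //.
rewrite lnM ?posrE ?mulr_gt0 // lnM ?posrE ?mulr_gt0 // lnM ?posrE //.
rewrite expRK !ln_powR -(ler_pM2l q_gt0).
have -> : q * (- M + (x * ln c + y * ln #|` A|%:R + z * ln (log2 #|` A|%:R))) =
    - (q * M) + (1 - 11 * alpha) * ln c
    + (- 8 * alpha ^+ 2 + 57 * alpha - 3) * ln #|` A|%:R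
    - 4 * (3 * alpha - 1) * ln (log2 #|` A|%:R).
  by rewrite /x /y /z; field; rewrite gt_eqF.
by move: H; rewrite /q; lra.
Qed.

Theorem theorem5 (R : realType) (C0 : R) (C0_gt0 : 0 < C0) :
  (exists2 K : R, 0 < K &
    forall (A : {fset R}) (alpha c : R),
      (1 < #|` A|)%N ->
      SzT_type C0 A alpha c ->
      K * (c `^ ((1 - 11 * alpha) / (3 * alpha ^+ 2 + 12 * alpha + 1))
           * #|` A|%:R `^ ((- 8 * alpha ^+ 2 + 57 * alpha - 3)
                            / (3 * alpha ^+ 2 + 12 * alpha + 1))
           * log2 #|` A|%:R `^ (- (4 * (3 * alpha - 1)
                                   / (3 * alpha ^+ 2 + 12 * alpha + 1))))
      <= #|` sumset A A|%:R)
  /\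
  (exists2 K : R, 0 < K &
    forall (A : {fset R}) (c : R),
      (1 < #|` A|)%N ->
      SzT_type C0 A 2 c ->
      K * (c `^ (- (21 / 37)) * #|` A|%:R `^ (79 / 37)
           * log2 #|` A|%:R `^ (- (20 / 37)))
      <= #|` sumset A A|%:R).
Proof.
have [K K_gt0 H] := sumset_ge C0.
split; exists K => // A c A1 SzT.
have := H A 2 c A1 SzT.
have -> : (1 - 11 * 2) / (3 * 2 ^+ 2 + 12 * 2 + 1) = - (21 / 37) :> R by field.
have -> : (- 8 * 2 ^+ 2 + 57 * 2 - 3) / (3 * 2 ^+ 2 + 12 * 2 + 1) = 79 / 37 :> R by field.
by have -> : 4 * (3 * 2 - 1) / (3 * 2 ^+ 2 + 12 * 2 + 1) = 20 / 37 :> R by field.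
Qed.
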